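(* Let $f(x)=\frac1n\sum_{i=1}^nf_i(x)$ on $\mathbb{R}^d$ where each $f_i$ is $\mu_i$-strongly convex and $L_i$-smooth, and let $x^*$ be the minimizer of $f$. Consider SGD with stepsize $\gamma_k:=\frac1{\sqrt{k+1}}\min\left\{\frac{f_{\mathcal S_k}(x^k)-\ell^*_{\mathcal S_k}}{\|\nabla f_{\mathcal S_k}(x^k)\|^2},\ \gamma_{k-1}\sqrt k\right\}$ for $k\ge1$, and $\gamma_0:=\min\left\{\frac{f_{\mathcal S_0}(x^0)-\ell^*_{\mathcal S_0}}{\|\nabla f_{\mathcal S_0}(x^0)\|^2},\ \gamma_b\right\}$. Then for every $K\ge1$, $$\mathbb{E}[f(\bar x^K)-f(x^* )]\le\frac{2\tilde LD^2_{\max}+2\hat\sigma_B^2}{\sqrt K},$$ where $\bar x^K=\frac1K\sum_{k=0}^{K-1}x^k$, $\tilde L:=\max\{\max_iL_i,\frac1{2\gamma_b}\}$, and $$D^2_{\max}:=\max\left\{\|x^0-x^*\|^2,\ \frac{2\gamma_b\hat\sigma^2_{B,\max}}{\min\left\{\frac{\mu_{\min}}{2L_{\max}},\mu_{\min}\gamma_b\right\}}\right\}$$ with $\mu_{\min}=\min_i\mu_i$, $L_{\max}=\max_iL_i$.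
   Context: Minibatches: fix a batch size $B$; at each iteration a subset $\mathcal S_k\subseteq[n]$ with $|\mathcal S_k|=B$ is sampled uniformly at random, independently across iterations. For $\mathcal S\subseteq[n]$, $f_{\mathcal S}:=\frac1{|\mathcal S|}\sum_{i\in\mathcal S}f_i$, $f^*_{\mathcal S}:=\inf_xf_{\mathcal S}(x)$, and $\ell^*_{\mathcal S}$ is a given real number with $\ell^*_{\mathcal S}\le f^*_{\mathcal S}$. SGD: $x^{k+1}=x^k-\gamma_k\nabla f_{\mathcal S_k}(x^k)$ from given $x^0$; $\gamma_b>0$ is a fixed constant; if $\nabla f_{\mathcal S_k}(x^k)=0$ the iterate is not updated. $\hat\sigma_B^2:=\mathbb{E}_{\mathcal S}[f_{\mathcal S}(x^* )-\ell^*_{\mathcal S}]$ with $\mathcal S$ uniform over subsets of size $B$; $\hat\sigma^2_{B,\max}:=\max_{|\mathcal S|=B}[f_{\mathcal S}(x^* )-\ell^*_{\mathcal S}]$. *)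

(* Defs.v *)
From HB Require Import structures.
From mathcomp Require Import all_boot all_order all_algebra.
From mathcomp Require Import all_classical all_reals all_analysis.
Set Implicit Arguments. Unset Strict Implicit. Unset Printing Implicit Defensive.
Import Order.TTheory GRing.Theory Num.Theory.
Import numFieldNormedType.Exports.
Local Open Scope ring_scope.

Section Defs.
Variable R : realType.
Variable d : nat.
Local Notation vec := 'rV[R]_d.

Definition dotv (u v : vec) : R := \sum_(j < d) u 0 j * v 0 j.
Definition sqnorm (u : vec) : R := dotv u u.
Definition enorm (u : vec) : R := Num.sqrt (sqnorm u).

Definition grad (f : vec -> R) (x : vec) : vec :=
  \row_(j < d) ('d f x (delta_mx 0 j : vec) : R).

Definition differentiable_everywhere (f : vec -> R) : Prop :=
  forall x : vec, differentiable f x.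

Definition strongly_convex (mu : R) (f : vec -> R) : Prop :=
  forall (x y : vec) (t : R), 0 <= t <= 1 ->
    f (t *: x + (1 - t) *: y) <=
      t * f x + (1 - t) * f y - mu / 2 * t * (1 - t) * sqnorm (x - y).

Definition smooth (L : R) (f : vec -> R) : Prop :=
  differentiable_everywhere f /\
  forall x y : vec, enorm (grad f x - grad f y) <= L * enorm (x - y).

Variable n : nat.

Definition fS (f : 'I_n -> vec -> R) (S : {set 'I_n}) (x : vec) : R :=
  (\sum_(i in S) f i x) / #|S|%:R.

Definition favg (f : 'I_n -> vec -> R) (x : vec) : R :=
  (\sum_(i < n) f i x) / n%:R.

(* max / min of a family over 'I_n (the default element is some value of the
   family, so it does not affect the result when n >= 1) *)
Definition maxI (F : 'I_n -> R) : R :=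
  \big[Num.max/head 0 [seq F i | i <- enum 'I_n]]_(i < n) F i.
Definition minI (F : 'I_n -> R) : R :=
  \big[Num.min/head 0 [seq F i | i <- enum 'I_n]]_(i < n) F i.

Definition batches (B : nat) : {set {set 'I_n}} := [set S : {set 'I_n} | #|S| == B].

Definition sigmaB (f : 'I_n -> vec -> R) (ell : {set 'I_n} -> R) (B : nat)
  (xs : vec) : R :=
  (\sum_(S in batches B) (fS f S xs - ell S)) / #|batches B|%:R.

Definition sigmaBmax (f : 'I_n -> vec -> R) (ell : {set 'I_n} -> R) (B : nat)
  (xs : vec) : R :=
  \big[Num.max/0]_(S in batches B) (fS f S xs - ell S).

Definition polyak_ratio (f : 'I_n -> vec -> R) (ell : {set 'I_n} -> R)
  (S : {set 'I_n}) (x : vec) : R :=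
  (fS f S x - ell S) / sqnorm (grad (fS f S) x).

(* SGD with the decreasing Polyak-type stepsize.  [sgd k] = (x^k, gamma_k).
   Convention when grad f_{S_k}(x^k) = 0: the ratio is +infinity, so the min
   is attained by the second argument (gamma_b for k = 0); the iterate is
   not updated. *)
Fixpoint sgd (f : 'I_n -> vec -> R) (ell : {set 'I_n} -> R) (gb : R)
  (x0 : vec) (Sk : nat -> {set 'I_n}) (k : nat) : vec * R :=
  match k with
  | 0 =>
      (x0, if grad (fS f (Sk 0)) x0 == 0 then gb
           else Num.min (polyak_ratio f ell (Sk 0) x0) gb)
  | k'.+1 =>
      let xg := sgd f ell gb x0 Sk k' in
      let x := xg.1 in
      let g := xg.2 in
      let x' := x - g *: grad (fS f (Sk k')) x in
      (x', (if grad (fS f (Sk k)) x' == 0 then g * Num.sqrt (k%:R)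
            else Num.min (polyak_ratio f ell (Sk k) x') (g * Num.sqrt (k%:R)))
           / Num.sqrt (k.+1%:R))
  end.

(* a realisation of the first K minibatches, extended arbitrarily afterwards *)
Definition sched (K : nat) (s : {ffun 'I_K -> {set 'I_n}}) (k : nat)
  : {set 'I_n} :=
  match insub k with Some i => s i | None => finset.set0 end.

(* sample space for K iterations: i.i.d. uniform size-B batches *)
Definition paths (K B : nat) : {set {ffun 'I_K -> {set 'I_n}}} :=
  [set s : {ffun 'I_K -> {set 'I_n}} | [forall k, #|s k| == B]].

Definition Epath (K B : nat) (X : {ffun 'I_K -> {set 'I_n}} -> R) : R :=
  (\sum_(s in paths K B) X s) / #|paths K B|%:R.

Definition xbar (f : 'I_n -> vec -> R) (ell : {set 'I_n} -> R) (gb : R)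
  (x0 : vec) (K : nat) (s : {ffun 'I_K -> {set 'I_n}}) : vec :=
  K%:R^-1 *: \sum_(k < K) (sgd f ell gb x0 (sched s) k).1.

End Defs.

(* Main.v *)
(* With a_k = sqrt(k+1) gamma_k, the recursion makes a_k nonincreasing,
   a_k <= gamma_b, a_k |grad f_{S_k}(x^k)|^2 <= f_{S_k}(x^k) - l_{S_k}, and the
   descent lemma gives a_k >= 1/(2 Ltil).  Expanding |x^{k+1} - xs|^2 and using
   strong convexity bounds every iterate's squared distance to xs by Dmax2.
   Dividing the same expansion by gamma_k and summing by parts (1/gamma_k is
   nondecreasing) gives, on every path,
     sum_k (2 - 1/sqrt(k+1)) (f_{S_k}(x^k) - f_{S_k}(xs))
       <= 2 Ltil Dmax2 sqrt K + sum_k (f_{S_k}(xs) - l_{S_k}) / sqrt(k+1).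
   Since x^k does not depend on S_k, taking expectations replaces f_{S_k} by f;
   Jensen's inequality finishes. *)

Require Import Defs.
From HB Require Import structures.
From mathcomp Require Import all_boot all_order all_algebra.
From mathcomp Require Import all_classical all_reals all_analysis.
From mathcomp Require Import perm ring lra.
Set Implicit Arguments. Unset Strict Implicit. Unset Printing Implicit Defensive.
Import Order.TTheory GRing.Theory Num.Theory.
Import numFieldNormedType.Exports.
Local Open Scope ring_scope.

(** * Euclidean inner product and squared norm *)

Section InnerProduct.
Context {R : realType} {d : nat}.
Implicit Types (u v w : 'rV[R]_d) (a : R).

Lemma dotvC u v : dotv u v = dotv v u.
Proof. by apply: eq_bigr => j _; rewrite mulrC. Qed.

Lemma dotvDl u v w : dotv (u + v) w = dotv u w + dotv v w.
Proof. by rewrite /dotv -big_split; apply: eq_bigr => j _; rewrite mxE mulrDl. Qed.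

Lemma dotvZl a u w : dotv (a *: u) w = a * dotv u w.
Proof. by rewrite /dotv big_distrr; apply: eq_bigr => j _; rewrite mxE -mulrA. Qed.

Lemma dotvNl u w : dotv (- u) w = - dotv u w.
Proof. by rewrite -scaleN1r dotvZl mulN1r. Qed.

Lemma dotvDr u v w : dotv u (v + w) = dotv u v + dotv u w.
Proof. by rewrite dotvC dotvDl !(dotvC u). Qed.

Lemma dotvZr a u w : dotv u (a *: w) = a * dotv u w.
Proof. by rewrite dotvC dotvZl dotvC. Qed.

Lemma dotvNr u w : dotv u (- w) = - dotv u w.
Proof. by rewrite dotvC dotvNl dotvC. Qed.

Lemma dotv_suml (I : finType) (P : pred I) (F : I -> 'rV[R]_d) w :
  dotv (\sum_(i | P i) F i) w = \sum_(i | P i) dotv (F i) w.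
Proof.
elim/big_rec2: _ => [|i _ u _ <-]; last by rewrite dotvDl.
by rewrite /dotv big1// => j _; rewrite mxE mul0r.
Qed.

Lemma sqnorm_ge0 u : 0 <= sqnorm u.
Proof. by apply: sumr_ge0 => j _; rewrite -expr2 sqr_ge0. Qed.

Lemma sqnorm_eq0 u : (sqnorm u == 0) = (u == 0).
Proof.
apply/eqP/eqP => [u0|->]; last by rewrite /sqnorm /dotv big1// => j _; rewrite mxE mul0r.
apply/rowP => j; rewrite mxE; apply/eqP; rewrite -sqrf_eq0 expr2.
have /psumr_eq0P H : forall i : 'I_d, true -> 0 <= u 0 i * u 0 i.
  by move=> i _; rewrite -expr2 sqr_ge0.
by rewrite H.
Qed.

Lemma sqnormZ a u : sqnorm (a *: u) = a ^+ 2 * sqnorm u.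
Proof. by rewrite /sqnorm dotvZl dotvZr mulrA expr2. Qed.

Lemma sqnormN u : sqnorm (- u) = sqnorm u.
Proof. by rewrite /sqnorm dotvNl dotvNr opprK. Qed.

Lemma sqnormB u v : sqnorm (u - v) = sqnorm u - 2 * dotv u v + sqnorm v.
Proof.
rewrite /sqnorm dotvDl !dotvDr !dotvNl !dotvNr (dotvC v u); ring.
Qed.

(** Expand [sqnorm (u - c *: v) >= 0] and divide by [c]. With a well-chosen [c] this takes the place
    of Cauchy-Schwarz below. *)
Lemma dotv_young u v (c : R) : 0 < c ->
  2 * dotv u v <= c^-1 * sqnorm u + c * sqnorm v.
Proof.
move=> c0; have := sqnorm_ge0 (u - c *: v).
rewrite sqnormB dotvZr sqnormZ => h.
rewrite -(ler_pM2l c0) mulrDr !mulrA divff ?gt_eqF// mul1r.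
by rewrite -expr2; lra.
Qed.

Lemma enorm_le_sqnorm (c : R) u v :
  enorm u <= c * enorm v -> sqnorm u <= c ^+ 2 * sqnorm v.
Proof.
move=> uv; rewrite -(sqr_sqrtr (sqnorm_ge0 u)) -(sqr_sqrtr (sqnorm_ge0 v)).
by rewrite -exprMn lerXn2r// ?nnegrE ?sqrtr_ge0// (le_trans _ uv)// sqrtr_ge0.
Qed.

End InnerProduct.

(** * Gradients and derivatives along lines *)

Section Gradient.
Context {R : realType} {d : nat}.
Implicit Types (f : 'rV[R]_d -> R) (x y v : 'rV[R]_d).

Lemma diff_grad f x v : differentiable f x -> 'd f x v = dotv (grad f x) v :> R.
Proof.
move=> df; rewrite {1}(row_sum_delta v) linear_sum.
by apply: eq_bigr => j _; rewrite linearZ mxE mulrC.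
Qed.

Lemma is_derive_grad f x v : differentiable f x ->
  is_derive x v f (dotv (grad f x) v).
Proof.
move=> df; apply: DeriveDef; first exact: diff_derivable.
by rewrite -diff_grad// deriveE.
Qed.

Lemma is_derive_line f x v (t : R) : differentiable f (x + t *: v) ->
  is_derive t (1 : R) (fun s : R => f (x + s *: v)) (dotv (grad f (x + t *: v)) v).
Proof.
move=> /(is_derive_grad v)[D E].
have eqf : (fun h : R => h^-1 *: (((fun s => f (x + s *: v)) \o shift t) (h *: 1) - f (x + t *: v)))
   = (fun h : R => h^-1 *: ((f \o shift (x + t *: v)) (h *: v) - f (x + t *: v))).
  apply/funext => h /=; congr (_ *: (f _ - _)).
  by rewrite [h *: 1]mulr1 scalerDl addrCA.
apply: DeriveDef; first by rewrite /derivable eqf.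
by rewrite -E /derive eqf.
Qed.

End Gradient.

(** * First-order consequences of strong convexity and smoothness *)

Section StronglyConvex.
Context {R : realType} {d : nat}.
Implicit Types (f : 'rV[R]_d -> R) (x y v : 'rV[R]_d).

(** Apply strong convexity at [x + h *: (y - x)], divide by [h] and let [h] tend to 0 from the
    right. *)
Lemma strongly_convex_grad m f x y : differentiable f x -> strongly_convex m f ->
  f x - f y <= dotv (grad f x) (x - y) - m / 2 * sqnorm (x - y).
Proof.
move=> dfx scf; set v := y - x.
suff : dotv (grad f x) v <= f y - f x - m / 2 * sqnorm (x - y).
  by rewrite /v -(opprB x y) dotvNr; lra.
have [D E] : is_derive (0 : R) (1 : R) (fun s : R => f (x + s *: v)) (dotv (grad f x) v).
  have := @is_derive_line _ _ f x v 0; rewrite scale0r addr0; exact.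
set c := m / 2 * sqnorm (x - y).
have cvgD := cvg_dnbhs_at_right D.
(* Strong convexity bounds the difference quotient by [f y - f x - c * (1 - h)]. Subtracting [c * h]
   makes the bound independent of [h] and leaves the limit unchanged. *)
pose q (h : R) := h^-1 *: (((fun s => f (x + s *: v)) \o shift 0) (h *: 1) - f (x + 0 *: v)) - c * h.
have qcvg : (q h @[h --> 0^'+] --> dotv (grad f x) v)%classic.
  rewrite -[dotv _ _]subr0 -{2}(mulr0 c) -E.
  apply: cvgB; first exact: cvgD.
  by apply: cvgM; [exact: cvg_cst | apply: cvg_at_right_filter; exact: cvg_id].
apply: (cvgr_to_le qcvg); near=> h.
have h0 : 0 < h by near: h; exact: nbhs_right_gt.
have h1 : h <= 1 by near: h; apply: nbhs_right_le.
rewrite /q /= [h *: 1]mulr1 addr0 scale0r addr0.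
have := scf y x h; rewrite (ltW h0) h1 => /(_ isT).
have -> : h *: y + (1 - h) *: x = x + h *: v.
  by rewrite /v scalerBr scalerBl scale1r addrCA addrA.
rewrite -(opprB x y) sqnormN -/c => H.
rewrite lerBlDr -ler_pdivlMl ?invr_gt0// invrK.
by move: H; rewrite /c; nra.
Unshelve. all: end_near.
Qed.

Lemma strongly_convexS m m' f : m <= m' -> strongly_convex m' f -> strongly_convex m f.
Proof.
move=> mm' scf x y t t01; apply: le_trans (scf x y t t01) _.
rewrite lerB// -!mulrA ler_wpM2r//.
by case/andP: t01 => t0 t1; rewrite !mulr_ge0 ?invr_ge0 ?subr_ge0 ?sqnorm_ge0.
Qed.

(** Subtract the linear and quadratic terms from [f] along the segment: the resulting [q] has
    nonpositive derivative on the open unit interval, so the mean value theorem gives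
    [q 1 <= q 0]. *)
Lemma smooth_quadratic_ub L f x v : 0 < L -> smooth L f ->
  f (x + v) <= f x + dotv (grad f x) v + L / 2 * sqnorm v.
Proof.
move=> L0 [df lip].
pose p (t : R) := f (x + t *: v).
pose dp (t : R) := dotv (grad f (x + t *: v)) v.
have pD (t : R) : is_derive t (1 : R) p (dp t) by exact: is_derive_line.
pose a : R := dotv (grad f x) v; pose b : R := L / 2 * sqnorm v.
pose q : R -> R := p - (id * cst a) - (id ^+ 2 * cst b).
have qE t : q t = p t - t * a - t ^+ 2 * b by [].
have qD (t : R) : is_derive t (1 : R) q (dp t - dotv (grad f x) v - 2 * t * (L / 2 * sqnorm v)).
  have D1 := is_deriveM (is_derive_id t (1 : R)) (is_derive_cst a t (1 : R)).
  have D2 := is_deriveM (is_deriveX 2 (is_derive_id t (1 : R))) (is_derive_cst b t (1 : R)).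
  have D3 := is_deriveB (is_deriveB (pD t) D1) D2.
  apply: (is_derive_eq D3).
  by rewrite /GRing.scale /= -/a -/b; ring.
have qc : {within `[0, 1], continuous q}%classic.
  apply: continuous_subspaceT => t; apply: differentiable_continuous.
  by apply/derivable1_diffP; case: (qD t).
have [t t01] := MVT ltr01 (fun t _ => qD t) qc.
rewrite !qE /p scale1r scale0r addr0 subr0 mulr1 expr1n expr0n /= !mul0r !mul1r.
move: t01; rewrite in_itv /= => /andP[t0 t1].
rewrite -/a; suff : dp t - a <= t * L * sqnorm v by move=> H1 H2; rewrite -lerBlDr -subr_le0 in H2 *; rewrite /b in H2; lra.
rewrite /dp /a -dotvNl -dotvDl.
(* The weight [t * L] balances the two halves: the Lipschitz bound makes each at most
   [t * L * sqnorm v]. *)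
have := dotv_young (grad f (x + t *: v) - grad f x) v (mulr_gt0 t0 L0).
have := enorm_le_sqnorm (lip (x + t *: v) x).
rewrite [x + _ - x]addrC addKr sqnormZ => H1 H2.
have tL0 : 0 < t * L by exact: mulr_gt0.
suff : (t * L)^-1 * sqnorm (grad f (x + t *: v) - grad f x) <= t * L * sqnorm v by lra.
rewrite ler_pdivrMl//; apply: le_trans H1 _; rewrite le_eqVlt; apply/orP; left.
by apply/eqP; ring.
Qed.

(** Adding the first-order inequalities between 0 and a nonzero [v] shows that the gradient is
    strongly monotone; Young's inequality with weight [m] then yields [m ^+ 2 <= L ^+ 2]. The result
    supplies positivity of every smoothness constant and the comparison of [minI mu] with
    [maxI L]. *)
Lemma strong_convexity_le_smoothness m L f : (0 < d)%N -> 0 < m ->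
  strongly_convex m f -> smooth L f -> m <= L.
Proof.
have arith (fv f0 gv g0 s r1 r2 : R) :
    fv - f0 <= gv - m / 2 * s -> f0 - fv <= - g0 - m / 2 * s ->
    2 * (gv - g0) <= r1 + m * s -> r1 <= r2 -> m * s <= r2 by lra.
move=> d0 m0 scf [df lip].
have [v v0] : exists v : 'rV[R]_d, 0 < sqnorm v.
  exists (delta_mx 0 (Ordinal d0)); rewrite lt_def sqnorm_ge0 andbT sqnorm_eq0.
  by apply/negP => /eqP /rowP /(_ (Ordinal d0)); rewrite !mxE !eqxx; apply/eqP/oner_neq0.
have lipv := lip v 0; rewrite subr0 in lipv.
have L0 : 0 <= L.
  have ev : 0 < enorm v by rewrite sqrtr_gt0.
  by rewrite -(pmulr_lge0 _ ev) (le_trans _ lipv)// sqrtr_ge0.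
have H1 := strongly_convex_grad 0 (df v) scf.
have H2 := strongly_convex_grad v (df 0) scf.
have H3 := enorm_le_sqnorm lipv.
have H4 := dotv_young (grad f v - grad f 0) v m0.
rewrite subr0 in H1; rewrite sub0r dotvNr sqnormN in H2.
have H5 : m^-1 * sqnorm (grad f v - grad f 0) <= m^-1 * (L ^+ 2 * sqnorm v).
  by rewrite ler_pM2l// invr_gt0.
rewrite dotvDl dotvNl in H4.
have H6 : m * sqnorm v <= m^-1 * (L ^+ 2 * sqnorm v).
  exact: arith H1 H2 H4 H5.
rewrite ler_pdivlMl// in H6.
by rewrite -(ler_pXn2r (_ : 0 < 2)%N) ?nnegrE ?(ltW m0)// -(ler_pM2r v0) expr2 -mulrA.
Qed.

End StronglyConvex.

(** * Convexity and smoothness of minibatch averages *)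

Section BatchObjective.
Context {R : realType} {d n : nat}.
Variables (f : 'I_n -> 'rV[R]_d -> R) (S : {set 'I_n}).
Hypothesis S0 : (0 < #|S|)%N.
Implicit Types (x y v : 'rV[R]_d).

Let cardS0 : #|S|%:R != 0 :> R.
Proof. by rewrite pnatr_eq0 -lt0n. Qed.

Lemma avg_le (F G : 'I_n -> R) : (forall i, i \in S -> F i <= G i) ->
  (\sum_(i in S) F i) / #|S|%:R <= (\sum_(i in S) G i) / #|S|%:R.
Proof. by move=> FG; rewrite ler_wpM2r// ?invr_ge0// ler_sum. Qed.

Lemma avg_affine (a b c : R) (F G : 'I_n -> R) :
  (\sum_(i in S) (a * F i + b * G i + c)) / #|S|%:R =
  a * ((\sum_(i in S) F i) / #|S|%:R) + b * ((\sum_(i in S) G i) / #|S|%:R) + c.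
Proof.
rewrite !big_split /= -!big_distrr /= sumr_const !mulrDl -!mulrA.
by rewrite -[c *+ _]mulr_natr mulfK.
Qed.

Lemma fS_strongly_convex m :
  (forall i, strongly_convex m (f i)) -> strongly_convex m (fS f S).
Proof.
move=> scf x y t t01; rewrite /fS -avg_affine.
by apply: avg_le => i _; apply: scf.
Qed.

Let fSE : fS f S = #|S|%:R^-1 *: \sum_(i in S) f i.
Proof. by apply/funext => y; rewrite /fS mulrC fctE fct_sumE. Qed.

Lemma differentiable_fS x :
  (forall i, differentiable (f i) x) -> differentiable (fS f S) x.
Proof.
move=> df; rewrite fSE; apply: differentiableZ; elim/big_ind: _ => //.
by move=> g h; exact: differentiableD.
Qed.

Lemma grad_fS x : (forall i, differentiable (f i) x) ->
  grad (fS f S) x = #|S|%:R^-1 *: \sum_(i in S) grad (f i) x.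
Proof.
move=> df; apply/rowP => j; rewrite !mxE summxE.
have dsum : is_derive x (delta_mx 0 j) (\sum_(i in S) f i) (\sum_(i in S) grad (f i) x 0 j).
  elim/big_rec2: _ => [|i g l _ dl]; first exact: (is_derive_cst (0 : R)).
  apply: is_deriveD => //; rewrite mxE -deriveE//; apply: DeriveDef => //.
  exact: diff_derivable.
rewrite -deriveE; last exact: differentiable_fS.
by rewrite fSE; have [_ ->] := is_deriveZ #|S|%:R^-1 dsum.
Qed.

(** The quadratic bounds of the components are averaged directly, which bypasses the Lipschitz
    property of the averaged gradient and its triangle inequality. *)
Lemma fS_quadratic_ub (M : R) x v :
  (forall i, exists2 l, 0 < l <= M & smooth l (f i)) ->
  fS f S (x + v) <= fS f S x + dotv (grad (fS f S) x) v + M / 2 * sqnorm v.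
Proof.
move=> smf; rewrite grad_fS; last by move=> i; have [l _ [+ _]] := smf i; apply.
rewrite dotvZl dotv_suml mulrC.
rewrite -[fS f S x]mul1r -[X in _ + X + _]mul1r /fS -avg_affine.
apply: avg_le => i _; rewrite !mul1r.
have [l /andP[l0 lM] sl] := smf i.
apply: le_trans (smooth_quadratic_ub x v l0 sl) _.
by rewrite lerD2l ler_wpM2r ?sqnorm_ge0// ler_pM2r.
Qed.

Lemma sqnorm_grad_le (M e : R) x : 0 < M ->
  (forall i, exists2 l, 0 < l <= M & smooth l (f i)) ->
  (forall y, e <= fS f S y) ->
  sqnorm (grad (fS f S) x) <= 2 * M * (fS f S x - e).
Proof.
move=> M0 smf lb; set g := grad _ _.
(* The displacement [- M^-1 *: g] minimises the quadratic upper bound, with value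
   [fS f S x - sqnorm g / (2 * M)]. *)
have := le_trans (lb _) (fS_quadratic_ub x (- M^-1 *: g) smf).
rewrite -/g dotvZr sqnormZ -/(sqnorm g).
have -> : M / 2 * ((- M^-1) ^+ 2 * sqnorm g) = M^-1 * sqnorm g / 2.
  by field; rewrite gt_eqF.
rewrite mulNr -ler_pdivrMl ?mulr_gt0// invfM.
move: (fS f S x) (sqnorm g) => a s H; rewrite -mulrA.
by move: (M^-1 * s) H => r H; lra.
Qed.

End BatchObjective.

(** Lets the facts on batch averages serve for the full objective. *)
Lemma favg_fS (R : realType) (d n : nat) (f : 'I_n -> 'rV[R]_d -> R) :
  favg f = fS f [set: 'I_n].
Proof.
apply/funext => x; rewrite /favg /fS cardsT card_ord.
by congr (_ / _); apply: eq_bigl => i; rewrite inE.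
Qed.

Lemma strongly_convex_jensen (R : realType) (d : nat) (g : 'rV[R]_d -> R) (m : R) :
  0 <= m -> strongly_convex m g -> forall (K : nat) (x : nat -> 'rV[R]_d), (0 < K)%N ->
  g (K%:R^-1 *: \sum_(k < K) x k) <= K%:R^-1 * \sum_(k < K) g (x k).
Proof.
move=> m0 scg [//|K] x _; elim: K => [|K IH].
  by rewrite !big_ord1 invr1 scale1r mul1r.
rewrite big_ord_recr [\sum_(k < K.+2) g _]big_ord_recr /=.
set N : R := K.+1%:R; set X := \sum_(k < _) _; set G := \sum_(k < _) _.
have N0 : 0 < N by rewrite ltr0n.
have -> : K.+2%:R = N + 1 :> R by rewrite /N natr1.
have N1 : N + 1 != 0 by rewrite gt_eqF// addr_gt0.
(* The new mean is the convex combination, with weight [N / (N + 1)], of the old mean and the new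
   point. *)
have t01 : 0 <= N / (N + 1) <= 1.
  by rewrite divr_ge0 ?addr_ge0 ?(ltW N0)//= ler_pdivrMr ?addr_gt0// mul1r lerDl.
have := scg (N^-1 *: X) (x K.+1) _ t01.
have -> : 1 - N / (N + 1) = (N + 1)^-1 by field.
have -> : (N / (N + 1)) *: (N^-1 *: X) = (N + 1)^-1 *: X.
  by rewrite scalerA mulrAC mulfV ?gt_eqF// mul1r.
rewrite -scalerDr => H; apply: le_trans H _; rewrite mulrDr lerBlDr.
apply: le_trans (_ : _ <= (N + 1)^-1 * G + (N + 1)^-1 * g (x K.+1)) _; last first.
  by rewrite lerDl !mulr_ge0 ?sqnorm_ge0 ?invr_ge0 ?addr_ge0 ?(ltW N0).
rewrite lerD2r mulrAC mulrC ler_pM2l ?invr_gt0 ?addr_gt0//.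
by rewrite -ler_pdivlMl.
Qed.

(** * Symmetry of uniform batches and resampling of one coordinate *)

Section Sampling.
Context {R : realType} {n B : nat}.

Lemma batches_gt0 : (B <= n)%N -> (0 < #|batches n B|)%N.
Proof. by move=> Bn; rewrite /batches card_draws card_ord bin_gt0. Qed.

(** The transposition of [i] and [j] permutes the batches and exchanges the two families. *)
Lemma card_batches_mem (i j : 'I_n) :
  #|[set S in batches n B | i \in S]| = #|[set S in batches n B | j \in S]|.
Proof.
pose h (S : {set 'I_n}) := tperm i j @: S.
have hinj : injective h by apply: imset_inj; exact: perm_inj.
rewrite -(card_preimset _ hinj); apply: eq_card => S.
rewrite !inE card_imset; last exact: perm_inj.
by rewrite -{1}(tpermR i j) mem_imset//; exact: perm_inj.
Qed.

Lemma sum_batches_avg (F : 'I_n -> R) : (0 < B)%N -> (0 < n)%N ->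
  \sum_(S in batches n B) (\sum_(i in S) F i) / #|S|%:R =
  #|batches n B|%:R * ((\sum_(i < n) F i) / n%:R).
Proof.
move=> B0 n0; pose c : R := #|[set S in batches n B | Ordinal n0 \in S]|%:R.
have sumE (G : 'I_n -> R) :
    \sum_(S in batches n B) \sum_(i in S) G i = c * \sum_(i < n) G i.
  rewrite (exchange_big_dep xpredT)//= big_distrr; apply: eq_bigr => i _ /=.
  rewrite sumr_const -mulr_natl /c (card_batches_mem _ i); congr (_%:R * _).
  by apply: eq_card => S; rewrite [RHS]inE.
(* Double counting: the constant function 1 determines [c] through [c * n = #|batches n B| * B],
   without binomial coefficients. *)
have := sumE (fun=> 1); rewrite sumr_const card_ord.
rewrite (eq_bigr (fun=> B%:R)); last first.
  by move=> S; rewrite inE sumr_const => /eqP ->.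
rewrite sumr_const -[X in X = _]mulr_natl => cE.
rewrite (eq_bigr (fun S : {set 'I_n} => (\sum_(i in S) F i) / B%:R)); last first.
  by move=> S; rewrite inE => /eqP ->.
rewrite -big_distrl/= sumE.
have B1 : B%:R != 0 :> R by rewrite pnatr_eq0 -lt0n.
have n1 : n%:R != 0 :> R by rewrite pnatr_eq0 -lt0n.
apply: (mulIf B1); apply: (mulIf n1); rewrite mulfVK//.
transitivity (c * n%:R * \sum_(i < n) F i); first by ring.
by rewrite -cE; field.
Qed.

Lemma paths_gt0 K : (B <= n)%N -> (0 < #|paths n K B|)%N.
Proof.
move=> /batches_gt0 /card_gt0P[S]; rewrite inE => SB; apply/card_gt0P.
by exists [ffun=> S]; rewrite inE; apply/forallP => k; rewrite ffunE.
Qed.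

(* The map [(s, S) |-> (s with entry k replaced by S, s k)] is an involution. *)
Lemma sum_paths_resample K (k : 'I_K)
    (G : {ffun 'I_K -> {set 'I_n}} -> {set 'I_n} -> R) :
  (forall (s s' : {ffun 'I_K -> {set 'I_n}}) S, (forall j, j != k -> s j = s' j) -> G s S = G s' S) ->
  #|batches n B|%:R * (\sum_(s in paths n K B) G s (s k)) =
  \sum_(s in paths n K B) \sum_(S in batches n B) G s S.
Proof.
move=> Gk; pose upd (s : {ffun 'I_K -> {set 'I_n}}) S :=
  [ffun j => if j == k then S else s j].
pose h (p : {ffun 'I_K -> {set 'I_n}} * {set 'I_n}) := (upd p.1 p.2, p.1 k).
have hK : involutive h.
  move=> [s S]; rewrite /h /= ffunE eqxx; congr (_, _); apply/ffunP => j.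
  by rewrite !ffunE; case: eqP => [->|].
have hP p : (p.1 \in paths n K B) && (p.2 \in batches n B) ->
    ((h p).1 \in paths n K B) && ((h p).2 \in batches n B).
  case: p => s S /=; rewrite !inE => /andP[/forallP sB SB].
  rewrite (sB k) andbT; apply/forallP => j; rewrite ffunE.
  by case: ifP.
rewrite [RHS]pair_big /= (reindex_inj (inv_inj hK)) /=.
rewrite (eq_bigl (fun p => (p.1 \in paths n K B) && (p.2 \in batches n B))); last first.
  by move=> p; apply/idP/idP => [/(hP (h p))|]; [rewrite hK | exact: hP].
rewrite (eq_bigr (fun p => G p.1 (p.1 k))); last first.
  by move=> [s S] _ /=; apply: Gk => j jk; rewrite ffunE (negPf jk).
rewrite -(pair_big (mem (paths n K B)) (mem (batches n B)) (fun s _ => G s (s k))) /=.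
by rewrite big_distrr; apply: eq_bigr => s _; rewrite sumr_const /= mulr_natl.
Qed.

End Sampling.

(** * Extrema of finite families *)

Section Extrema.
Context {R : realType} {n : nat}.
Implicit Types F : 'I_n -> R.

Lemma le_maxI F i : F i <= maxI F.
Proof. exact: le_bigmax. Qed.

Lemma minI_le F i : minI F <= F i.
Proof. exact: bigmin_le_cond. Qed.

Lemma minI_gt0 F : (0 < n)%N -> (forall i, 0 < F i) -> 0 < minI F.
Proof.
move=> n0 F0; apply: lt_bigmin => //.
(* The default of the iterated minimum is the first value of the family, hence positive. *)
have := size_enum_ord n; case: (enum 'I_n) => [n1|i s _]; last exact: F0.
by rewrite -n1 in n0.
Qed.

End Extrema.

(** Summation by parts. Keeping [- D N.+1] in the bound lets the induction close: since
    [M - D N.+1 >= 0], replacing [g N] by the smaller [g N.+1] only enlarges it. *)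
Lemma weighted_telescope_le (R : realFieldType) (w D g : nat -> R) (M : R) N :
  (forall k, (k < N.+1)%N -> w k <= (D k - D k.+1) / g k) ->
  (forall k, (k < N.+1)%N -> 0 < g k) ->
  (forall k, (k < N)%N -> g k.+1 <= g k) ->
  (forall k, (k <= N.+1)%N -> D k <= M) ->
  \sum_(k < N.+1) w k <= (M - D N.+1) / g N.
Proof.
move=> wD g0; elim: N wD g0 => [|N IH] wD g0 gN DM.
  rewrite big_ord1; apply: le_trans (wD _ _) _ => //.
  by rewrite ler_wpM2r ?invr_ge0 ?(ltW (g0 _ _))// lerB// DM.
rewrite big_ord_recr /=; apply: le_trans (lerD (IH _ _ _ _) (wD _ _)) _ => //.
- by move=> k kN; apply: wD; apply: ltnW.
- by move=> k kN; apply: g0; apply: ltnW.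
- by move=> k kN; apply: gN; apply: ltnW.
- by move=> k kN; apply: DM; apply: leqW.
have -> : (M - D N.+2) / g N.+1 =
    (M - D N.+1) / g N.+1 + (D N.+1 - D N.+2) / g N.+1.
  by rewrite -mulrDl addrA subrK.
rewrite lerD2r ler_wpM2l ?subr_ge0 ?DM//.
by rewrite lef_pV2 ?posrE ?g0// gN.
Qed.

(** * Deterministic analysis along one sequence of batches *)

Section SGDPath.
Context {R : realType} {d n : nat}.
Variables (f : 'I_n -> 'rV[R]_d -> R) (ell : {set 'I_n} -> R) (gb : R).
Variables (x0 xs : 'rV[R]_d) (Sk : nat -> {set 'I_n}) (K : nat).
(** These stand for the least [mu], the largest [L], [Ltil], [sigmaBmax] and [Dmax2]; only the
    inequalities assumed next are used. *)
Variables (m M T sm Dmax : R).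
Hypotheses (m0 : 0 < m) (mM : m <= M) (gb0 : 0 < gb).
Hypotheses (MT : M <= T) (gbT : 1 / (2 * gb) <= T).
Hypothesis smf : forall i, exists2 l, 0 < l <= M & smooth l (f i).
Hypothesis scf : forall i, strongly_convex m (f i).
Hypothesis Sk0 : forall k, (k < K)%N -> (0 < #|Sk k|)%N.
Hypothesis ellb : forall k x, (k < K)%N -> ell (Sk k) <= fS f (Sk k) x.
Hypothesis smb : forall k, (k < K)%N -> fS f (Sk k) xs - ell (Sk k) <= sm.
Hypotheses (D0 : sqnorm (x0 - xs) <= Dmax) (sm0 : 0 <= sm).
Hypothesis Dsm : 2 * gb * sm / Num.min (m / (2 * M)) (m * gb) <= Dmax.

Let x k := (sgd f ell gb x0 Sk k).1.
Let g k := (sgd f ell gb x0 Sk k).2.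
Let c k : R := Num.sqrt k.+1%:R.
Let D k := sqnorm (x k - xs).
Let G k := grad (fS f (Sk k)) (x k).

Let M0 : 0 < M. Proof. exact: lt_le_trans m0 mM. Qed.
Let T0 : 0 < T. Proof. exact: lt_le_trans M0 MT. Qed.
Let c_ge1 k : 1 <= c k.
Proof. by rewrite -[X in X <= _]sqrtr1 ler_sqrt ?ler1n ?ltr0n. Qed.
Let c_gt0 k : 0 < c k. Proof. exact: lt_le_trans ltr01 (c_ge1 k). Qed.

(** Treats both branches of the recursion: [t] is [gb] at the start and [g k * c k] of the previous
    index afterwards. The lower bound on the ratio comes from [sqnorm_grad_le]. *)
Let polyak_bounds k (t : R) : (k < K)%N -> (2 * T)^-1 <= t ->
  let a := if G k == 0 then t else Num.min (polyak_ratio f ell (Sk k) (x k)) t in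
  [/\ (2 * T)^-1 <= a, a <= t & a * sqnorm (G k) <= fS f (Sk k) (x k) - ell (Sk k)].
Proof.
move=> kK tT /=; have [->|G0] := eqVneq (G k) 0.
  by rewrite tT lexx /sqnorm /dotv big1 ?mulr0 ?subr_ge0 ?ellb// => j _; rewrite mxE mul0r.
have sG : 0 < sqnorm (G k) by rewrite lt_def sqnorm_eq0 G0 sqnorm_ge0.
split; last 1 first.
- by rewrite -ler_pdivlMr// ge_min lexx.
- rewrite le_min tT andbT /polyak_ratio -/(G k) ler_pdivlMr// ler_pdivrMl ?mulr_gt0//.
  apply: le_trans (sqnorm_grad_le (Sk0 kK) (x k) T0 _ (fun y => ellb y kK)) _ => //.
  move=> i; have [l /andP[l0 lM] sl] := smf i; exists l => //.
  by rewrite l0 (le_trans lM).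
- by rewrite ge_min lexx orbT.
Qed.

(* [g k * c k] is the step size with its factor 1/sqrt(k+1) removed: the
   recursion makes it nonincreasing, starting below [gb]. *)
Let step_size k : (k < K)%N ->
  [/\ (2 * T)^-1 <= g k * c k, g k * c k <= gb &
      g k * c k * sqnorm (G k) <= fS f (Sk k) (x k) - ell (Sk k)].
Proof.
elim: k => [|k IH] kK.
  have Tgb : (2 * T)^-1 <= gb.
    rewrite invf_ple ?posrE ?mulr_gt0//; move: gbT.
    by rewrite mul1r invfM ler_pdivrMl.
  by have := polyak_bounds kK Tgb; rewrite /g /c /= sqrtr1 mulr1.
have [lo hi _] := IH (ltnW kK).
have [a1 a2 a3] := polyak_bounds kK lo.
rewrite {1 2 3}/g /= -/(x k) -/(g k) divfK ?gt_eqF ?c_gt0//.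
by split => //; apply: le_trans a2 hi.
Qed.

Let step_size_le k : (k.+1 < K)%N -> g k.+1 * c k.+1 <= g k * c k.
Proof.
move=> kK; have [lo _ _] := step_size (ltnW kK).
have [_ a2 _] := polyak_bounds kK lo.
by rewrite {1}/g /= divfK ?gt_eqF ?c_gt0.
Qed.

Let g_gt0 k : (k < K)%N -> 0 < g k.
Proof.
move=> /step_size[+ _ _] => /(lt_le_trans _) H.
by rewrite -(pmulr_lgt0 _ (c_gt0 k)) H// invr_gt0 mulr_gt0.
Qed.

Let g_le k : (k < K)%N -> g k <= gb.
Proof.
move=> kK; have [_ + _] := step_size kK; apply: le_trans.
by rewrite ler_peMr// ltW// g_gt0.
Qed.

(** Expand the square of [x k - xs - g k *: G k]: strong convexity controls the cross term, and the
    Polyak ratio controls the squared gradient, leaving a factor [1 / c k]. *)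
Let one_step k : (k < K)%N -> D k.+1 <= (1 - m * g k) * D k
  - 2 * g k * (fS f (Sk k) (x k) - fS f (Sk k) xs)
  + g k * ((fS f (Sk k) (x k) - ell (Sk k)) / c k).
Proof.
move=> kK; have g0 := g_gt0 kK.
have [_ _] := step_size kK; rewrite mulrAC -ler_pdivlMr// => H1.
have dff : forall i, differentiable (f i) (x k).
  by move=> i; have [l _ [+ _]] := smf i; apply.
have H2 := strongly_convex_grad xs (differentiable_fS (Sk k) dff)
  (fS_strongly_convex (Sk0 kK) scf).
have -> : D k.+1 = D k - 2 * (g k * dotv (G k) (x k - xs)) + g k * (g k * sqnorm (G k)).
  have -> : D k.+1 = sqnorm (x k - xs - g k *: G k) by rewrite addrAC.
  rewrite sqnormB sqnormZ dotvZr.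
  by rewrite (dotvC _ (G k)) expr2 -mulrA.
rewrite -/(G k) -/(D k) in H2.
rewrite -(ler_pM2l g0) in H1; rewrite -(ler_pM2l g0) in H2.
move: H1 H2; move: (g k * (_ / _)) (g k * (g k * _)) => r1 r2.
move: (dotv _ _) (D k) (fS f (Sk k) (x k)) (fS f (Sk k) xs) => w D' a b.
by move: (g k) => g'; lra.
Qed.

Let excess_ge0 k y : (k < K)%N -> 0 <= fS f (Sk k) y - ell (Sk k).
Proof. by move=> kK; rewrite subr_ge0 ellb. Qed.

(* If [m * g k <= 1] the new distance is a convex combination of the old one and
   [2 * sm / m]; otherwise the contraction term is negative and
   [2 * gb * sm <= Dmax / 2] suffices, because [m / (2 * M) <= 1 / 2]. *)
Let D_le k : (k <= K)%N -> D k <= Dmax.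
Proof.
elim: k => [//|k IH] kK; have Dk := IH (ltnW kK).
have g0 := g_gt0 kK; have gle := g_le kK.
have Dk0 : 0 <= D k := sqnorm_ge0 _.
have H : D k.+1 <= (1 - m * g k) * D k + 2 * g k * sm.
  apply: le_trans (one_step kK) _.
  have e0 := excess_ge0 (x k) kK; have sb := smb kK.
  have H1 : g k * ((fS f (Sk k) (x k) - ell (Sk k)) / c k) <=
            g k * (fS f (Sk k) (x k) - ell (Sk k)).
    by rewrite ler_pM2l// ler_pdivrMr// ler_peMr.
  move: H1; move: (g k * (_ / _)) => r H1.
  have H3 := mulr_ge0 (ltW g0) e0.
  have H4 : 0 <= g k * (sm - (fS f (Sk k) xs - ell (Sk k))).
    by rewrite mulr_ge0 ?subr_ge0// ltW.
  move: H1 H3 H4; move: (fS f (Sk k) (x k)) (fS f (Sk k) xs) (ell _) => a b e.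
  by move: (g k) (D k) => g' D'; lra.
have Dm0 : 0 <= Dmax := le_trans Dk0 Dk.
have mn0 : 0 < Num.min (m / (2 * M)) (m * gb).
  by rewrite lt_min !mulr_gt0 ?invr_gt0 ?mulr_gt0.
have Dsm' := Dsm; rewrite ler_pdivrMr// in Dsm'.
have [mg1|mg1] := leP (m * g k) 1.
  have sD : 2 * sm <= m * Dmax.
    have : 2 * gb * sm <= Dmax * (m * gb).
      by apply: le_trans Dsm' _; rewrite ler_wpM2l// ge_min lexx orbT.
    by move=> H9; rewrite -(ler_pM2l gb0); lra.
  apply: le_trans H _.
  have H5 : (1 - m * g k) * D k <= (1 - m * g k) * Dmax by rewrite ler_wpM2l// subr_ge0.
  rewrite -(ler_pM2l g0) in sD; by move: H5 sD; lra.
apply: le_trans H _.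
have H5 : (1 - m * g k) * D k <= 0 by rewrite mulr_le0_ge0// subr_le0 ltW.
have H6 : 2 * g k * sm <= 2 * gb * sm by rewrite ler_wpM2r// ler_pM2l.
have H7 : 2 * gb * sm <= Dmax.
  apply: le_trans Dsm' _; rewrite -[leRHS]mulr1 ler_wpM2l// ge_min.
  by rewrite ler_pdivrMr ?mulr_gt0// mul1r (le_trans mM)//; move: M0; lra.
by move: H5 H6 H7; lra.
Qed.

Lemma sgd_path_bound : (0 < K)%N ->
  \sum_(k < K) (2 - (Num.sqrt k.+1%:R)^-1) *
      (fS f (Sk k) (sgd f ell gb x0 Sk k).1 - fS f (Sk k) xs) <=
  2 * T * Dmax * Num.sqrt K%:R +
  \sum_(k < K) (fS f (Sk k) xs - ell (Sk k)) / Num.sqrt k.+1%:R.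
Proof.
(* Splitting the excess over [ell] at [xs] moves [1 / c k] of the loss gap to the left, whence the
   weight [2 - 1 / c k]. The contraction term [m * g k * D k] is dropped. *)
pose w k := (2 - (c k)^-1) * (fS f (Sk k) (x k) - fS f (Sk k) xs)
  - (fS f (Sk k) xs - ell (Sk k)) / c k.
have wE k : (k < K)%N -> w k <= (D k - D k.+1) / g k.
  move=> kK; have g0 := g_gt0 kK; rewrite ler_pdivlMr//.
  have := one_step kK; have : 0 <= m * g k * D k.
    by rewrite !mulr_ge0 ?sqnorm_ge0 ?(ltW m0) ?(ltW g0).
  rewrite /w; move: (c k)^-1 (g k) (D k) (D k.+1) => c' g' D1 D2.
  move: (fS f (Sk k) (x k)) (fS f (Sk k) xs) (ell _) => a b e; lra.
case: K D_le step_size step_size_le g_gt0 wE => // K' Dle stepK stepL gK wK _.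
have gle k : (k < K')%N -> g k.+1 <= g k.
  move=> kK; rewrite -(ler_pM2r (c_gt0 k)); apply: le_trans (stepL _ kK).
  by rewrite ler_pM2l ?gK// ler_sqrt// ler_nat.
rewrite -lerBlDr -sumrB; apply: le_trans (weighted_telescope_le wK gK gle Dle) _.
(* Here [c K'] is the square root of [K'.+1], the number of iterations: this is the source of the
   factor [Num.sqrt K%:R]. *)
have gi : (g K')^-1 <= 2 * T * c K'.
  have [+ _ _] := stepK _ (ltnSn K').
  rewrite -ler_pdivrMr// -invfM => H.
  by rewrite -[leRHS]invrK lef_pV2// posrE ?invr_gt0 ?gK// !mulr_gt0.
have Dm0 : 0 <= Dmax := le_trans (sqnorm_ge0 _) D0.
apply: le_trans (_ : Dmax / g K' <= _).
  by rewrite ler_wpM2r ?invr_ge0 ?(ltW (gK _ (ltnSn _)))// gerBl sqnorm_ge0.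
by rewrite [2 * T * _]mulrC -mulrA ler_wpM2l.
Qed.

End SGDPath.

(** This is the independence of the iterate at [k] from the batch drawn at [k]. *)
Lemma sgd_iterate_local (R : realType) (d n : nat) (f : 'I_n -> 'rV[R]_d -> R)
    (ell : {set 'I_n} -> R) (gb : R) (x0 : 'rV[R]_d) (S S' : nat -> {set 'I_n}) k :
  (forall j, (j < k)%N -> S j = S' j) ->
  (sgd f ell gb x0 S k).1 = (sgd f ell gb x0 S' k).1.
Proof.
(* The step size at [j] already depends on batch [j], so the full state needs agreement up to [j]
   inclusive. *)
have full j : (forall i, (i <= j)%N -> S i = S' i) ->
    sgd f ell gb x0 S j = sgd f ell gb x0 S' j.
  elim: j => [|j IH] SS' /=; first by rewrite SS'.
  by rewrite IH ?SS'// => i ij; apply: SS'; apply: leqW.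
case: k => [|k] SS' /=; first exact: erefl.
by rewrite (full k SS') (SS' k (ltnSn k)).
Qed.

(** With [a], [b] the consecutive roots, [b ^+ 2 = a ^+ 2 + 1] makes [1 / b <= 2 * (b - a)]
    equivalent to [0 <= (b - a) ^+ 2]. *)
Lemma sum_inv_sqrt_le (R : realType) K :
  \sum_(k < K) (Num.sqrt k.+1%:R)^-1 <= 2 * Num.sqrt K%:R :> R.
Proof.
elim: K => [|K IH]; first by rewrite big_ord0 sqrtr0 mulr0.
rewrite big_ord_recr /=; set b : R := Num.sqrt K.+1%:R.
have b0 : 0 < b by rewrite sqrtr_gt0 ltr0n.
have a0 : 0 <= Num.sqrt K%:R :> R := sqrtr_ge0 _.
have a2 : Num.sqrt K%:R ^+ 2 = K%:R :> R by rewrite sqr_sqrtr.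
have b2 : b ^+ 2 = Num.sqrt K%:R ^+ 2 + 1 by rewrite a2 sqr_sqrtr// natr1.
apply: le_trans (lerD IH (lexx _)) _; move: b2 a0; move: (Num.sqrt K%:R) => a b2 a0.
rewrite -lerBrDl -(ler_pM2r b0) mulVf ?gt_eqF//.
have := sqr_ge0 (b - a); rewrite !expr2 in b2 *; clear -b2; nra.
Qed.

(** * Means over all schedules *)

Section Expectation.
Context {R : realType} {d n B K : nat}.
Variables (f : 'I_n -> 'rV[R]_d -> R) (ell : {set 'I_n} -> R) (gb : R).
Variables (x0 xs : 'rV[R]_d).
Hypotheses (n0 : (0 < n)%N) (B0 : (0 < B)%N) (Bn : (B <= n)%N).

Lemma sched_ord (s : {ffun 'I_K -> {set 'I_n}}) (k : 'I_K) : sched s k = s k.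
Proof. by rewrite /sched valK. Qed.

Let cardb0 : #|batches n B|%:R != 0 :> R.
Proof. by rewrite pnatr_eq0 -lt0n batches_gt0. Qed.

(** Resampling entry [k] leaves the iterate at [k] unchanged, and averaging over the fresh batch
    turns [fS] into [favg]. *)
Lemma sum_paths_fS (k : 'I_K) :
  \sum_(s in paths n K B) (fS f (s k) (sgd f ell gb x0 (sched s) k).1 - fS f (s k) xs) =
  \sum_(s in paths n K B) (favg f (sgd f ell gb x0 (sched s) k).1 - favg f xs).
Proof.
apply: (mulfI cardb0).
pose X s := (sgd f ell gb x0 (@sched n K s) k).1.
pose G s S := fS f S (X s) - fS f S xs.
have XE (s s' : {ffun 'I_K -> {set 'I_n}}) : (forall j, j != k -> s j = s' j) -> X s = X s'.
  move=> ss'; apply: sgd_iterate_local => j jk; rewrite /sched.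
  case: insubP => [i _ ij|_]; last exact: erefl.
  by apply: ss'; apply/eqP => ik; rewrite -ij ik ltnn in jk.
have GE (s s' : {ffun 'I_K -> {set 'I_n}}) S : (forall j, j != k -> s j = s' j) -> G s S = G s' S.
  by move=> /XE XX; rewrite /G XX.
rewrite (sum_paths_resample GE) big_distrr; apply: eq_bigr => s _.
by rewrite /G sumrB !sum_batches_avg// -mulrBr.
Qed.

Lemma sum_paths_excess (k : 'I_K) :
  \sum_(s in paths n K B) (fS f (s k) xs - ell (s k)) =
  #|paths n K B|%:R * sigmaB f ell B xs.
Proof.
apply: (mulfI cardb0).
rewrite (sum_paths_resample (G := fun _ S => fS f S xs - ell S))//.
by rewrite sumr_const -[LHS]mulr_natl /sigmaB mulrCA [_%:R * (_ / _)]mulrCA mulfV// mulr1.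
Qed.

End Expectation.

(** * From the pathwise bound to the expected suboptimality *)

Unset Implicit Arguments.

Theorem theorem4 (R : realType) (d n B : nat)
  (f : 'I_n -> 'rV[R]_d -> R) (mu L : 'I_n -> R)
  (ell : {set 'I_n} -> R) (gb : R) (x0 xs : 'rV[R]_d) (K : nat) :
  (0 < n)%N -> (0 < B)%N -> (B <= n)%N ->
  (forall i, 0 < mu i) ->
  (forall i, strongly_convex (mu i) (f i)) ->
  (forall i, smooth (L i) (f i)) ->
  (forall x, favg f xs <= favg f x) ->
  (forall (S : {set 'I_n}) x, #|S| = B -> ell S <= fS f S x) ->
  0 < gb ->
  (1 <= K)%N ->
  let Ltil := Num.max (maxI L) (1 / (2 * gb)) in
  let Dmax2 := Num.max (sqnorm (x0 - xs))
      (2 * gb * sigmaBmax f ell B xs /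
       Num.min (minI mu / (2 * maxI L)) (minI mu * gb)) in
  Epath B (fun s : {ffun 'I_K -> {set 'I_n}} => favg f (xbar f ell gb x0 s) - favg f xs)
    <= (2 * Ltil * Dmax2 + 2 * sigmaB f ell B xs) / Num.sqrt (K%:R).
Proof.
move=> n0 B0 Bn mu0 scf smf xsmin ellb gb0 K0; cbv zeta.
set T : R := Num.max _ (1 / _); set Dmax : R := Num.max (sqnorm _) _.
have K1 : 0 < K%:R :> R by rewrite ltr0n.
have sK : 0 < Num.sqrt K%:R :> R by rewrite sqrtr_gt0.
have P0 : 0 < #|paths n K B|%:R :> R by rewrite ltr0n paths_gt0.
have sig0 : 0 <= sigmaB f ell B xs.
  rewrite /sigmaB divr_ge0//; apply: sumr_ge0 => S; rewrite inE => /eqP SB.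
  by rewrite subr_ge0 ellb.
have T0 : 0 < T by rewrite lt_max divr_gt0 ?orbT// mulr_gt0.
have Dmax0 : 0 <= Dmax by rewrite le_max sqnorm_ge0.
(* In dimension 0 there is one point, so the left side vanishes; [mu i <= L i] requires a nonzero
   vector and is available only for [d > 0]. *)
have [d0|d0] := posnP d.
  have E0 s : favg f (xbar f ell gb x0 s) - favg f xs = 0 :> R.
    have -> : xbar f ell gb x0 s = xs.
      by apply/rowP => -[j jd]; exfalso; move: jd; rewrite d0.
    exact: subrr.
  rewrite /Epath big1 => [|s _]; last exact: E0.
  rewrite mul0r; apply: divr_ge0 (ltW sK); apply: addr_ge0 (mulr_ge0 _ sig0) => //.
  exact: mulr_ge0 (mulr_ge0 _ (ltW T0)) Dmax0.
set m := minI mu in Dmax Dmax0 *; set M := maxI L in T T0 Dmax Dmax0 *.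
have m0 : 0 < m by exact: minI_gt0.
have muL i : mu i <= L i by exact: (strong_convexity_le_smoothness d0 (mu0 i) (scf i)).
have mM : m <= M.
  by apply: le_trans (minI_le _ (Ordinal n0)) (le_trans (muL _) (le_maxI _ _)).
have smf' i : exists2 l, 0 < l <= M & smooth l (f i).
  by exists (L i) => //; rewrite (lt_le_trans (mu0 i) (muL i)) le_maxI.
have scf' i : strongly_convex m (f i).
  exact: strongly_convexS (minI_le _ _) (scf i).
set sm := sigmaBmax f ell B xs in Dmax Dmax0 *.
have sm0 : 0 <= sm by exact: bigmax_ge_id.
have path_bound s : s \in paths n K B ->
    \sum_(k < K) (2 - (Num.sqrt k.+1%:R)^-1) *
      (fS f (s k) (sgd f ell gb x0 (sched s) k).1 - fS f (s k) xs) <=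
    2 * T * Dmax * Num.sqrt K%:R +
    \sum_(k < K) (fS f (s k) xs - ell (s k)) / Num.sqrt k.+1%:R.
  rewrite inE => /forallP sB.
  have sB' k (kK : (k < K)%N) : #|sched s k| = B.
    by rewrite -[k]/(val (Ordinal kK)) sched_ord; apply/eqP.
  under eq_bigr do rewrite -sched_ord.
  under [X in _ <= _ + X]eq_bigr do rewrite -sched_ord.
  apply: (@sgd_path_bound _ _ _ f ell gb x0 xs (sched s) K m M T sm) => //.
  - by rewrite le_max lexx.
  - by rewrite le_max lexx orbT.
  - by move=> k kK; rewrite sB'.
  - by move=> k y kK; rewrite ellb ?sB'.
  - move=> k kK; apply: (@le_bigmax_cond _ _ _ _ _ _ (fun S => fS f S xs - ell S)).
    by rewrite inE sB'.
  - by rewrite le_max lexx.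
  - by rewrite le_max lexx orbT.
(* Jensen's inequality on each path, followed by an exchange of the two sums. *)
have step1 : \sum_(s in paths n K B) (favg f (xbar f ell gb x0 s) - favg f xs) <=
   K%:R^-1 * \sum_(k < K) \sum_(s in paths n K B)
     (favg f (sgd f ell gb x0 (sched s) k).1 - favg f xs).
  rewrite exchange_big big_distrr; apply: ler_sum => s _ /=.
  rewrite sumrB sumr_const card_ord mulrBr -[favg f xs *+ K]mulr_natl mulKf ?gt_eqF//.
  rewrite lerB// /xbar favg_fS.
  apply: (strongly_convex_jensen (ltW m0) _ (fun k => (sgd f ell gb x0 (sched s) k).1) K0).
  by apply: fS_strongly_convex => //; rewrite cardsT card_ord.
have step2 : \sum_(k < K) \sum_(s in paths n K B)
     (favg f (sgd f ell gb x0 (sched s) k).1 - favg f xs) <=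
   \sum_(s in paths n K B) \sum_(k < K) (2 - (Num.sqrt k.+1%:R)^-1) *
      (fS f (s k) (sgd f ell gb x0 (sched s) k).1 - fS f (s k) xs).
  rewrite [leRHS]exchange_big; apply: ler_sum => k _ /=.
  (* By independence the term with index [k] has a nonnegative mean, so its
     weight [2 - 1/sqrt(k+1) >= 1] can be lowered to 1; it may be negative on
     individual paths. *)
  rewrite -big_distrr /= sum_paths_fS// ler_peMl//.
    by apply: sumr_ge0 => s _; rewrite subr_ge0 xsmin.
  rewrite lerBrDr -lerBrDl (_ : 2 - 1 = 1 :> R); last by ring.
  by rewrite invf_le1 ?sqrtr_gt0 ?ltr0n// -[X in X <= _]sqrtr1 ler_sqrt ?ler1n ?ltr0n.
have step3 : \sum_(s in paths n K B) \sum_(k < K) (2 - (Num.sqrt k.+1%:R)^-1) *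
      (fS f (s k) (sgd f ell gb x0 (sched s) k).1 - fS f (s k) xs) <=
    #|paths n K B|%:R * (2 * T * Dmax * Num.sqrt K%:R) +
    \sum_(k < K) \sum_(s in paths n K B) (fS f (s k) xs - ell (s k)) / Num.sqrt k.+1%:R.
  rewrite [X in _ <= _ + X]exchange_big mulr_natl -sumr_const -big_split /=.
  exact: ler_sum path_bound.
have step4 : \sum_(k < K) \sum_(s in paths n K B) (fS f (s k) xs - ell (s k)) / Num.sqrt k.+1%:R
   <= #|paths n K B|%:R * sigmaB f ell B xs * (2 * Num.sqrt K%:R).
  under eq_bigr do rewrite -big_distrl/= sum_paths_excess//.
  by rewrite -big_distrr ler_wpM2l ?sum_inv_sqrt_le// mulr_ge0// ltW.
rewrite /Epath ler_pdivrMr//; apply: le_trans step1 _.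
rewrite ler_pdivrMl//.
apply: (le_trans step2); apply: (le_trans step3).
move: step4; rewrite -(lerD2l (#|paths n K B|%:R * (2 * T * Dmax * Num.sqrt K%:R))).
move=> /le_trans; apply.
(* Both terms carry one factor [Num.sqrt K%:R]; writing [K] as its square turns the remaining bound
   into an identity. *)
have KE : K%:R = Num.sqrt K%:R ^+ 2 :> R by rewrite sqr_sqrtr// ltW.
move: sK KE; move: (Num.sqrt K%:R) => r r0 ->.
rewrite le_eqVlt; apply/orP; left; apply/eqP.
by field; rewrite gt_eqF.
Qed.
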